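(* Let $M\in\mathbb{N}$, and let $\varphi_i:\mathbb{R}\to\mathbb{R}$, $i=1,\dots,M$, be continuous functions, with $\varphi_i$ odd for each $i\neq M$. Assume that for some $q\ge 1$ and $C>0$ one has $|\varphi_i(t)|\le C(1+|t|^q)$ for all $t\in\mathbb{R}$ and $i=1,\dots,M$. Suppose that for every sequence $(v_k)$ in $L^\infty([0,1])$ such that $\varphi_i(v_k)\rightharpoonup 0$ in $L^1([0,1])$ for all $i=1,\dots,M-1$, one also has $\varphi_M(v_k)\rightharpoonup 0$ in $L^1([0,1])$. Then the functions $\varphi_1,\dots,\varphi_M$ are linearly dependent.
   Context: $[0,1]$ is equipped with Lebesgue measure, functions are real-valued, and $\rightharpoonup$ denotes weak convergence as $k\to\infty$. $\varphi_i(v_k)$ denotes the composition $\varphi_i\circ v_k$. Linear dependence is over $\mathbb{R}$, as functions on $\mathbb{R}$. *)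

(* Defs.v *)
From HB Require Import structures.
From mathcomp Require Import all_boot all_order all_algebra.
From mathcomp Require Import all_classical all_reals all_analysis.
Import Order.TTheory GRing.Theory Num.Theory.
Import numFieldNormedType.Exports.

Set Implicit Arguments.
Unset Strict Implicit.
Unset Printing Implicit Defensive.

Local Open Scope classical_set_scope.
Local Open Scope ring_scope.

(* Functions on [0,1] are represented by functions on R, their values outside
   [0,1] being irrelevant because mu01 vanishes there. *)
Definition mu01 (R : realType) : {measure set (measurableTypeR R) -> \bar R} :=
  mrestr (@lebesgue_measure R) (measurable_itv `[0 : R, 1]).

(* [LfunType mu p1] is the space of functions itself, not its a.e. quotient, so
   its p-norm is only a seminorm. A linear functional bounded by this seminorm
   is the same thing as an element of the dual of the quotient L^p(mu). *)
Definition bounded_functional d (T : measurableType d) (R : realType)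
    (mu : {measure set T -> \bar R}) (p : \bar R) (p1 : (1 <= p)%E)
    (l : LfunType mu p1 -> R) : Prop :=
  exists K : R, forall f : LfunType mu p1,
    `|l f| <= K * fine ('N[mu]_p[EFin \o f])%E.

(* The convergence includes that the u k and f are in L^p(mu). *)
Definition weak_cvg d (T : measurableType d) (R : realType)
    (mu : {measure set T -> \bar R}) (p : \bar R) (p1 : (1 <= p)%E)
    (u : nat -> T -> R) (f : T -> R) : Prop :=
  exists (Hu : forall k, u k \in Lfun mu p) (Hf : f \in Lfun mu p),
    forall l : {linear LfunType mu p1 -> R^o},
      bounded_functional l ->
      l (Lfun_Sub p1 (Hu k)) @[k --> \oo] --> l (Lfun_Sub p1 Hf).
Arguments weak_cvg {d T R} mu {p} p1 u f.

Definition linearly_dependent (R : realType) (n : nat) (phi : 'I_n -> R -> R)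
    : Prop :=
  exists2 c : 'I_n -> R, exists i, c i != 0 &
    forall t : R, \sum_(i < n) c i * phi i t = 0.

(* Main.v *)
Require Import Defs.
From HB Require Import structures.
From mathcomp Require Import all_boot all_order all_algebra.
From mathcomp Require Import all_classical all_reals all_analysis.
From mathcomp Require Import measurable_realfun ess_sup_inf ring lra.
Import Order.TTheory GRing.Theory Num.Theory.
Import numFieldNormedType.Exports.

Local Open Scope classical_set_scope.
Local Open Scope ring_scope.

(** Suppose that phi is linearly independent.  Then there are as many points
    t_a as functions such that the matrix of the phi_j (t_a) is invertible
    ([linearly_dependent_or_unitmx]), hence coefficients c_a with
    sum_a c_a phi_j (t_a) = 0 for j < M and = 1 for j = M.  The hypothesis
    about sequences rules this out, in the following way.

    Oscillating functions realize every finitely supported probability measure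
    sum_a w_a delta_(t_a) as a weak limit ([weak_cvg_mean]): there are bounded
    v_k with f (v_k) converging weakly to the constant sum_a w_a f (t_a) for
    all f vanishing at 0.  So for nonnegative weights w_a of sum 1, if
    sum_a w_a phi_i (t_a) = 0 for all i < M, then sum_a w_a phi_M (t_a) = 0.
    With the points t and - t and equal weights, the oddness of the other
    functions shows that phi_M is odd as well.  Once all the phi_j are odd, a
    negative coefficient c_a at t_a is the same as the positive coefficient
    - c_a at - t_a, so the signed combination above is, after normalization,
    one with probability weights: a contradiction.

    The v_k are independent identically distributed digits ([digit]): [0,1[ is
    cut into intervals of lengths w_a, each of them is cut again in the same
    proportions, and so on; v_k is t_a on the a-th pieces of generation k.  For
    a function g of the digit with mean m, the functions g (v_k) - m are
    orthogonal in L^2 and have the same norm ([integral_digit_sqr]).  Weak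
    convergence in L^1 then needs no description of the dual space: if l is
    bounded by K times the L^1 norm, Bessel's inequality, obtained by evaluating
    l at sum_(k < p) l (y_k) y_k, shows that the squares of the l (y_k) have a
    finite sum, so that l (y_k) tends to 0 ([bounded_functional_cvg0]). *)

(** * Linear independence and evaluation at points *)

(** The points are chosen one at a time.  While there are fewer points than
    functions, some nonzero combination y of the functions vanishes at all of
    them; if it does not vanish identically, a point where it is nonzero extends
    the list and keeps the rows of the evaluation matrix independent. *)
Lemma linearly_dependent_or_unitmx (R : realType) (n : nat)
    (phi : 'I_n -> R -> R) :
  linearly_dependent phi \/
  exists t : 'I_n -> R, (\matrix_(i, j) phi j (t i)) \in unitmx.
Proof.
have [|indep] := pselect (linearly_dependent phi); [by left|right].
suff grow r : (r <= n)%N ->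
    exists t : 'I_r -> R, row_free (\matrix_(i < r, j < n) phi j (t i)).
  by have [t tfree] := grow n (leqnn n); exists t; rewrite -row_free_unit.
elim: r => [|r IHr] rn.
  by exists (fun=> 0); rewrite /row_free [X in \rank X]flatmx0 mxrank0.
have [t tfree] := IHr (ltnW rn); set A := \matrix_(_, _) _ in tfree.
have [y yN0 Ay0] : exists2 y : 'cV[R]_n, y != 0 & A *m y = 0.
  have : cokermx A != 0.
    rewrite -mxrank_eq0 mxrank_coker (eqP tfree).
    by rewrite subn_eq0 -ltnNge.
  case/matrix0Pn => i [j Kij]; exists (col j (cokermx A)).
    by apply/cV0Pn; exists i; rewrite mxE.
  by rewrite colE mulmxA mulmx_coker mul0mx.
(* The next point is one where the combination y does not vanish. *)
have [s sy] : exists s, (\row_j phi j s) *m y != 0.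
  apply: contrapT => /forallNP ally0; apply: indep.
  exists (fun i => y i ord0); first exact/cV0Pn.
  move=> s; have /negP := ally0 s; rewrite negbK => /eqP/matrixP/(_ ord0 ord0).
  rewrite !mxE => {2}<-; apply: eq_bigr => i _.
  by rewrite !mxE mulrC.
exists (fun i : 'I_r.+1 => if unlift ord_max i is Some j then t j else s).
set B := \matrix_(_, _) _.
apply: inj_row_free => u uB0.
have splitB (v : 'rV_r.+1) :
    v *m B =
      v 0 ord_max *: (\row_j phi j s) + (\row_i v 0 (lift ord_max i)) *m A.
  apply/rowP => j; rewrite !mxE (bigD1_ord ord_max)//= !mxE unlift_none.
  by congr (_ + _); apply: eq_bigr => i _; rewrite !mxE liftK.
have umax0 : u 0 ord_max = 0.
  have /eqP : u *m B *m y = 0 by rewrite uB0 mul0mx.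
  rewrite splitB mulmxDl -mulmxA Ay0 mulmx0 addr0 -scalemxAl scaler_eq0.
  by rewrite (negbTE sy) orbF => /eqP.
have ulift0 : \row_i u 0 (lift ord_max i) = 0.
  apply: (row_free_inj tfree).
  by rewrite mul0mx -uB0 splitB umax0 scale0r add0r.
apply/rowP => i; rewrite mxE; case: (unliftP ord_max i) => [j ->|->//].
by move/rowP/(_ j): ulift0; rewrite !mxE.
Qed.

(** * The digits of a point under repeated subdivision *)

Definition cell {R : realType} (A : nat -> R) (s l : R) (a : nat) : set R :=
  `[s + l * A a, s + l * A a.+1[%classic.

(** For numbers 0 = A 0 <= ... <= A N = 1 the cells cut the interval of origin
    s and length l in the proportions A a.+1 - A a.  The k-th digit is read
    after k further subdivisions of the cell containing x; it is 0 at the points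
    x outside of the interval. *)
Fixpoint digit {R : realType} (N : nat) (A g : nat -> R) (k : nat) (s l x : R)
    : R :=
  \sum_(a < N) \1_(cell A s l a) x *
    if k is k'.+1
    then digit N A g k' (s + l * A a) (l * (A a.+1 - A a)) x else g a.

Section digits.
Context {R : realType} {N : nat} {A : nat -> R}.
Hypothesis A_nd : {homo A : a b / (a <= b)%N >-> a <= b}.
Implicit Types (g : nat -> R) (k a : nat) (s l x : R).

Lemma cell_inj s l a b x : 0 <= l ->
  cell A s l a x -> cell A s l b x -> a = b.
Proof.
move=> l0.
wlog ab : a b / (a <= b)%N => [hwlog|] xa xb.
  by case: (leqP a b) => [|/ltnW] ab; [|apply/esym]; exact: hwlog.
move: ab; rewrite leq_eqVlt => /predU1P[//|ab].
move: xa xb; rewrite /cell/= !in_itv/= => /andP[_ xa] /andP[xb _].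
have := lt_le_trans xa (le_trans _ xb).
by rewrite ltxx lerD2l ler_wpM2l// ?A_nd// => /(_ isT).
Qed.

Lemma sum_cell (h : nat -> R) s l a x : 0 <= l -> (a < N)%N ->
  cell A s l a x -> \sum_(b < N) \1_(cell A s l b) x * h b = h a.
Proof.
move=> l0 aN xa; rewrite (bigD1 (Ordinal aN))//= indicE mem_set// mul1r.
rewrite big1 ?addr0// => b ba; rewrite indicE memNset ?mul0r// => xb.
by rewrite -(inj_eq val_inj) /= (cell_inj s l b a x l0 xb xa) eqxx in ba.
Qed.

Lemma sum_cell0 (h : nat -> R) s l x :
  (forall a, (a < N)%N -> ~ cell A s l a x) ->
  \sum_(b < N) \1_(cell A s l b) x * h b = 0.
Proof.
move=> xN; rewrite big1// => b _; rewrite indicE memNset ?mul0r//.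
exact/xN/ltn_ord.
Qed.

Lemma cell_width_ge0 l a : 0 <= l -> 0 <= l * (A a.+1 - A a).
Proof. by move=> l0; rewrite mulr_ge0// subr_ge0 A_nd. Qed.

Lemma digit0_cell g s l a x : 0 <= l -> (a < N)%N ->
  cell A s l a x -> digit N A g 0 s l x = g a.
Proof. exact: sum_cell. Qed.

Lemma digitS_cell g k s l a x : 0 <= l -> (a < N)%N -> cell A s l a x ->
  digit N A g k.+1 s l x = digit N A g k (s + l * A a) (l * (A a.+1 - A a)) x.
Proof.
exact: (sum_cell (fun a => digit N A g k (s + l * A a) (l * (A a.+1 - A a)) x)).
Qed.

Lemma digit_outside g k s l x :
  (forall a, (a < N)%N -> ~ cell A s l a x) -> digit N A g k s l x = 0.
Proof.
move=> xN; case: k => [|k]; first exact: sum_cell0.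
exact: (sum_cell0 (fun a =>
  digit N A g k (s + l * A a) (l * (A a.+1 - A a)) x)).
Qed.

(** The condition f 0 = 0 is what makes the identity true outside of the
    interval, where digits are 0. *)
Lemma comp_digit (f : R -> R) g k s l x : f 0 = 0 -> 0 <= l ->
  f (digit N A g k s l x) = digit N A (f \o g) k s l x.
Proof.
move=> f0; elim: k s l => [|k IHk] s l l0;
  have [[a [aN xa]]|/forallNP xN] :=
    pselect (exists a, (a < N)%N /\ cell A s l a x).
- by rewrite !(digit0_cell _ s l a).
- by rewrite !digit_outside ?f0// => a aN xa; apply: (xN a).
- by rewrite !(digitS_cell _ _ s l a)// IHk// cell_width_ge0.
- by rewrite !digit_outside ?f0// => a aN xa; apply: (xN a).
Qed.

Lemma measurable_digit g k s l : measurable_fun setT (digit N A g k s l).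
Proof.
elim: k s l => [|k IHk] s l /=; apply: measurable_sum => a;
  apply: measurable_funM => //; apply: measurable_indic; exact: measurable_itv.
Qed.

Lemma digit_bounded g k s l x : 0 <= l ->
  `|digit N A g k s l x| <= \sum_(a < N) `|g a|.
Proof.
elim: k s l => [|k IHk] s l l0;
  have [[a [aN xa]]|/forallNP xN] :=
    pselect (exists a, (a < N)%N /\ cell A s l a x).
- rewrite (digit0_cell _ s l a)// (bigD1 (Ordinal aN))//= lerDl.
  by rewrite sumr_ge0.
- by rewrite digit_outside ?normr0 ?sumr_ge0// => a aN xa; apply: (xN a).
- by rewrite (digitS_cell _ _ s l a)// IHk// cell_width_ge0.
- by rewrite digit_outside ?normr0 ?sumr_ge0// => a aN xa; apply: (xN a).
Qed.

End digits.

(** * Orthogonality of the centered digits *)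

Lemma ge0_integral_itv_split {R : realType}
    (mu : {measure set (measurableTypeR R) -> \bar R}) (f : R -> \bar R)
    (x : nat -> R) (N : nat) :
  measurable_fun setT f -> (forall y, 0 <= f y)%E ->
  {homo x : a b / (a <= b)%N >-> a <= b} ->
  (\int[mu]_(y in `[x 0%N, x N[) f y =
   \sum_(a < N) \int[mu]_(y in `[x a, x a.+1[) f y)%E.
Proof.
move=> mf f0 x_nd; elim: N => [|N IHN].
  by rewrite big_ord0 set_itvco0 integral_set0.
rewrite big_ord_recr/= -IHN -ge0_integral_setU//=.
- by rewrite -itv_bndbnd_setU//= ?bnd_simp x_nd.
- exact: measurable_funTS.
- rewrite disj_set2E; apply/eqP; rewrite -subset0 => y /=.
  rewrite !in_itv/= => -[/andP[_ yx] /andP[]].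
  by rewrite leNgt yx.
Qed.

(** The centered digits are orthogonal with the same L^2 norm, and orthogonal to
    the constants.  The constant c0 is there for the induction on the number of
    terms: on the cell a the digit 0 is the constant g a, which is absorbed into
    c0, and the digit k.+1 is the digit k of that cell, so that the induction
    hypothesis applies to the cell.  Summing over the cells, the cross term
    vanishes because m is the mean of g. *)
Lemma integral_digit_sqr {R : realType}
    (mu : {measure set (measurableTypeR R) -> \bar R}) (N : nat)
    (A g : nat -> R) (m : R)
    (muE : forall a b, 0 <= a -> a <= b -> b <= 1 ->
      mu `[a, b[%classic = (b - a)%:E)
    (A_nd : {homo A : a b / (a <= b)%N >-> a <= b})
    (A0 : A 0%N = 0) (AN : A N = 1)
    (mE : m = \sum_(a < N) (A a.+1 - A a) * g a)
    (p : nat) (c : nat -> R) (c0 s l : R) :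
  0 <= s -> 0 <= l -> s + l <= 1 ->
  (\int[mu]_(x in `[s, (s + l)%R[)
     ((c0 + \sum_(k < p) c k * (digit N A g k s l x - m)) ^+ 2)%:E =
   (l * (c0 ^+ 2 + (\sum_(a < N) (A a.+1 - A a) * (g a - m) ^+ 2)
         * \sum_(k < p) c k ^+ 2))%:E)%E.
Proof.
set V := \sum_(a < N) _ * _ ^+ 2.
have w1 : \sum_(a < N) (A a.+1 - A a) = 1.
  rewrite -(big_mkord xpredT (fun a => A a.+1 - A a)).
  by rewrite telescope_sumr// AN A0 subr0.
elim: p c c0 s l => [|p IHp] c c0 s l s0 l0 sl1.
  under eq_integral do rewrite big_ord0 addr0.
  rewrite integral_cst//= muE// ?lerDl// big_ord0 mulr0 addr0 -EFinM mulrC.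
  by rewrite (addrC s) addrK.
set f := fun x => ((c0 + _) ^+ 2)%:E.
have -> : `[s, s + l[%classic = `[s + l * A 0%N, s + l * A N[%classic.
  by rewrite A0 AN mulr0 mulr1 addr0.
rewrite (@ge0_integral_itv_split _ mu _ (fun a => s + l * A a)); last 3 first.
- apply/measurable_EFinP/measurable_funX/measurable_funD => //.
  apply: measurable_sum => k; apply: measurable_funM => //.
  by apply: measurable_funB => //; exact: measurable_digit.
- by move=> x; rewrite lee_fin sqr_ge0.
- by move=> a b ab; rewrite lerD2l ler_wpM2l// A_nd.
have A01 a : (a <= N)%N -> 0 <= A a <= 1.
  by move=> aN; rewrite -A0 -AN !A_nd.
(* One cell: the induction hypothesis with c0 + c 0 * (g a - m) for c0. *)
have cellE (a : 'I_N) :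
    (\int[mu]_(x in `[(s + l * A a)%R, (s + l * A a.+1)%R[) f x =
    (l * (A a.+1 - A a) * ((c0 + c 0%N * (g a - m)) ^+ 2 +
       V * \sum_(k < p) c k.+1 ^+ 2))%:E)%E.
  have -> : s + l * A a.+1 = (s + l * A a) + l * (A a.+1 - A a) by ring.
  have la0 : 0 <= l * (A a.+1 - A a) by exact: cell_width_ge0.
  have /andP[Aa0 Aa1] := A01 a (ltnW (ltn_ord a)).
  have /andP[Sa0 Sa1] := A01 a.+1 (ltn_ord a).
  rewrite -(IHp (fun k => c k.+1) _ (s + l * A a))//; last 2 first.
  - by rewrite addr_ge0// mulr_ge0.
  - have -> : s + l * A a + l * (A a.+1 - A a) = s + l * A a.+1 by ring.
    by rewrite (le_trans _ sl1)// lerD2l ler_piMr.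
  apply: eq_integral => x; rewrite inE => xa; rewrite /f; congr ((_ ^+ 2)%:E).
  have {}xa : cell A s l a x.
    rewrite /cell.
    by rewrite (_ : _ + _ * A a.+1 = s + l * A a + l * (A a.+1 - A a)); [|ring].
  rewrite big_ord_recl (digit0_cell A_nd _ _ _ a)// -addrA; congr (_ + (_ + _)).
  apply: eq_bigr => k _.
  by rewrite (digitS_cell A_nd _ _ _ _ a).
rewrite (eq_bigr _ (fun a _ => cellE a)) sumEFin; congr EFin.
set S := \sum_(k < p) _.
rewrite [\sum_(k < p.+1) _]big_ord_recl -[\sum_(k < p) _]/S.
have w0 : \sum_(a < N) (A a.+1 - A a) * (g a - m) = 0.
  under eq_bigr do rewrite mulrBr.
  by rewrite sumrB -mE -mulr_suml w1 mul1r subrr.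
transitivity (\sum_(a < N) (l * ((c0 ^+ 2 + V * S) * (A a.+1 - A a) +
    c0 * c 0%N *+ 2 * ((A a.+1 - A a) * (g a - m)) +
    c 0%N ^+ 2 * ((A a.+1 - A a) * (g a - m) ^+ 2)))).
  by apply: eq_bigr => a _; ring.
rewrite -mulr_sumr !big_split/= -!mulr_sumr -/V w1 w0.
by congr (_ * _); ring.
Qed.

(** * Bounded functionals on orthogonal sequences *)

Lemma Lfun_sumZE d (T : measurableType d) (R : realType)
    (mu : {measure set T -> \bar R}) (r : \bar R) (r1 : (1 <= r)%E)
    (p : nat) (c : nat -> R) (y : nat -> LfunType mu r1) (x : T) :
  (\sum_(k < p) c k *: y k : LfunType mu r1) x = \sum_(k < p) c k * y k x.
Proof.
exact: (big_morph (fun f : LfunType mu r1 => f x) (id1 := 0)).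
Qed.

(** Bessel's inequality for a functional l bounded by the L^1 norm.  With
    f := sum_(k < p) l (y_k) y_k and S := l f = sum_(k < p) l (y_k) ^ 2, one has
    S <= K |f|_1 and, by the inequality |f| <= (D + f ^ 2 / D) / 2,
    |f|_1 <= (D + G S / D) / 2.  The choice D = K G gives S <= K ^ 2 G
    for every p. *)
Lemma bounded_functional_cvg0 d (T : measurableType d) (R : realType)
    (mu : {measure set T -> \bar R}) (y : nat -> LfunType mu (lexx 1%E)) (G : R)
    (l : {linear LfunType mu (lexx 1%E) -> R^o}) :
  mu setT = 1%E ->
  (forall (c : nat -> R) (p : nat),
    (\int[mu]_x ((\sum_(k < p) c k * y k x) ^+ 2)%:E <=
     (G * \sum_(k < p) c k ^+ 2)%:E)%E) ->
  bounded_functional l -> l (y k) @[k --> \oo] --> (0 : R).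
Proof.
move=> mu1 ysqr [K lK].
pose S p : R := \sum_(k < p) l (y k) ^+ 2.
have S0 p : 0 <= S p by apply: sumr_ge0 => k _; exact: sqr_ge0.
(* Adding 1 makes K' and G' positive, so that one can divide by D. *)
pose K' : R := `|K| + 1; pose G' : R := `|G| + 1.
have K'0 : 0 < K' by rewrite ltr_wpDl.
have G'0 : 0 < G' by rewrite ltr_wpDl.
pose D : R := K' * G'; have D0 : 0 < D by rewrite mulr_gt0.
have Sbound p : S p <= K' ^+ 2 * G'.
  pose f : LfunType mu (lexx 1%E) := \sum_(k < p) l (y k) *: y k.
  have lf : l f = S p.
    rewrite linear_sum; apply: eq_bigr => k _.
    by rewrite linearZ /= expr2.
  have mf : measurable_fun setT f by [].
  have fN : fine ('N[mu]_1[EFin \o f])%E <= (D + D^-1 * (G' * S p)) / 2.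
    rewrite -lee_fin finite_norm_fine Lnorm1.
    apply: (@le_trans _ _
        (\int[mu]_x ((D / 2)%:E + (D^-1 / 2)%:E * ((f x) ^+ 2)%:E))%E).
      apply: ge0_le_integral => //=.
      - by apply/measurable_EFinP; exact: measurableT_comp.
      - apply/measurable_EFinP/measurable_funD => //.
        apply: measurable_funM => //.
        exact: measurable_funX.
      - move=> x _; rewrite -EFinM -EFinD lee_fin -subr_ge0.
        have -> : D / 2 + D^-1 / 2 * f x ^+ 2 - `|f x| =
                  (D - `|f x|) ^+ 2 / (2 * D).
          by rewrite -(real_normK (num_real (f x))); field; exact: lt0r_neq0.
        by rewrite divr_ge0 ?sqr_ge0 ?mulr_ge0 ?ltW.
    rewrite ge0_integralD//=; last 3 first.
    - by move=> x _; rewrite lee_fin divr_ge0 ?ltW.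
    - move=> x _; rewrite -EFinM lee_fin.
      by rewrite mulr_ge0 ?sqr_ge0// divr_ge0 ?invr_ge0 ?ltW.
    - apply/measurable_EFinP; apply: measurable_funM => //; exact: measurable_funX.
    rewrite integral_cst// mu1 mule1 ge0_integralZl//; last 3 first.
    - by apply/measurable_EFinP; exact: measurable_funX.
    - by move=> x _; rewrite lee_fin sqr_ge0.
    - by rewrite lee_fin divr_ge0 ?invr_ge0 ?ltW.
    have fG : (\int[mu]_x ((f x) ^+ 2)%:E <= (G' * S p)%:E)%E.
      under eq_integral
        do rewrite /f (Lfun_sumZE _ _ _ mu _ _ p (fun k => l (y k)) y).
      apply: (le_trans (ysqr (fun k => l (y k)) p)).
      rewrite lee_fin; apply: ler_wpM2r; first exact: S0.
      by rewrite (le_trans (ler_norm G))// lerDl.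
    have -> : (D + D^-1 * (G' * S p)) / 2 = D / 2 + D^-1 / 2 * (G' * S p) by ring.
    rewrite EFinD leeD2l// [leRHS]EFinM lee_wpmul2l//.
    by rewrite lee_fin divr_ge0 ?invr_ge0 ?ltW.
  have : S p <= K' * ((D + D^-1 * (G' * S p)) / 2).
    rewrite -{1}lf (le_trans (ler_norm _))// (le_trans (lK f))//.
    have N0 : 0 <= fine ('N[mu]_1[EFin \o f])%E by rewrite fine_ge0// Lnorm_ge0.
    apply: (@le_trans _ _ (K' * fine ('N[mu]_1[EFin \o f])%E)).
      by rewrite ler_wpM2r// (le_trans (ler_norm K))// lerDl.
    by rewrite ler_wpM2l// ltW.
  have -> : K' * ((D + D^-1 * (G' * S p)) / 2) = (K' ^+ 2 * G' + S p) / 2.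
    by rewrite /D; field; rewrite !lt0r_neq0.
  lra.
pose u : R^nat := fun k => l (y k) ^+ 2.
have u0 : u @ \oo --> (0 : R).
  apply: cvg_series_cvg_0; apply: nondecreasing_is_cvgn.
    by apply: nondecreasing_series => k _ _; exact: sqr_ge0.
  exists (K' ^+ 2 * G') => _ [p _ <-].
  by rewrite /series/= big_mkord; exact: Sbound.
apply/norm_cvg0P.
rewrite (_ : (fun k => `|l (y k)|) = Num.sqrt \o u); last first.
  by apply/funext => k; rewrite /u/= sqrtr_sqr.
rewrite -[X in _ --> X]sqrtr0.
by apply: (cvg_comp _ _ u0); exact: sqrt_continuous.
Qed.

(** * Weak limits of the digits on the unit interval *)

Lemma mu01_itv {R : realType} (a b : R) : 0 <= a -> a <= b -> b <= 1 ->
  mu01 R `[a, b[%classic = (b - a)%:E.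
Proof.
move=> a0 ab b1; rewrite /mu01/= /mrestr setIidl; last first.
  move=> x /=; rewrite !in_itv/= => /andP[ax xb].
  by rewrite (le_trans a0)//= (le_trans (ltW xb)).
rewrite lebesgue_measure_itv/= lte_fin.
by case: ltgtP ab => // -> _; rewrite subrr.
Qed.

Lemma mu01_setT {R : realType} : mu01 R setT = 1%E.
Proof.
by rewrite /mu01/= /mrestr setTI lebesgue_measure_itv/= lte_fin ltr01 -EFinB subr0.
Qed.

Lemma ge0_integral_mu01 {R : realType} (f : R -> \bar R) :
  measurable_fun setT f -> (forall x, 0 <= f x)%E ->
  (\int[mu01 R]_x f x = \int[mu01 R]_(x in `[0%R, 1%R[) f x)%E.
Proof.
move=> mf f0.
have mN : measurable (~` `[0, 1[%classic : set (measurableTypeR R)).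
  exact: measurableC.
rewrite (ge0_negligible_integral mN)//; first by rewrite setTD setCK.
rewrite /mu01/= /mrestr.
have -> : ~` `[0, 1[%classic `&` `[0, 1]%classic = [set 1 : R].
  apply/seteqP; split => x /=; rewrite !in_itv/=; last first.
    by move=> ->; rewrite ltxx andbF ler01 lexx.
  move=> [/negP + /andP[x0 x1]]; rewrite x0/= -leNgt => x1'.
  by apply/eqP; rewrite eq_le x1.
exact: lebesgue_measure_set1.
Qed.

Lemma bounded_Lfun d (T : measurableType d) (R : realType)
    (mu : {measure set T -> \bar R}) (p : \bar R) (f : T -> R) (B : R) :
  (1 <= p)%E -> mu setT \is a fin_num -> measurable_fun setT f ->
  (forall x, `|f x| <= B) -> f \in Lfun mu p.
Proof.
move=> p1 mufin mf fB.
suff : f \in Lfun mu +oo%E by apply: Lfun_subset => //; exact: leey.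
apply/andP; split; rewrite inE//= /finite_norm unlock /Lnorm.
case: ifPn => // _; apply: (@le_lt_trans _ _ B%:E); last exact: ltry.
by apply: ess_sup_ler => x; rewrite lee_fin.
Qed.

Lemma integral_functional d (T : measurableType d) (R : realType)
    (mu : {measure set T -> \bar R}) :
  exists l : {linear LfunType mu (lexx 1%E) -> R^o},
    bounded_functional l /\ forall f, l f = \int[mu]_x f x.
Proof.
have fi (f : LfunType mu (lexx 1%E)) : mu.-integrable setT (EFin \o f).
  by apply/Lfun1_integrable; exact: LfunP.
pose I (f : LfunType mu (lexx 1%E)) : R^o := \int[mu]_x f x.
have lI : linear I.
  move=> a f g; have fif := fi (a *: f); have fig := fi g.
  rewrite /I [LHS](RintegralD measurableT fif fig); congr (_ + _).
  exact: (RintegralZl _ measurableT (fi f)).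
pose lM := GRing.isLinear.Build _ _ _ _ _ lI.
pose l : {linear LfunType mu (lexx 1%E) -> R^o} := HB.pack I lM.
exists l; split => //; exists 1 => f; rewrite mul1r Lnorm1.
exact: le_normr_Rintegral.
Qed.

(** Integration is a bounded functional that separates the constants. *)
Lemma weak_cvg_cst_unique d (T : measurableType d) (R : realType)
    (mu : {measure set T -> \bar R}) (u : nat -> T -> R) (a b : R) :
  mu setT = 1%E ->
  weak_cvg mu (lexx 1%E) u (cst a) -> weak_cvg mu (lexx 1%E) u (cst b) -> a = b.
Proof.
move=> mu1 [Hu1 [Ha ua]] [Hu2 [Hb ub]].
have [l [lb lE]] := integral_functional _ _ _ mu.
have lcst c (Hc : cst c \in Lfun mu 1%E) : l (Lfun_Sub (lexx 1%E) Hc) = c.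
  by rewrite lE/= Rintegral_cst// mu1 mulr1.
rewrite -(lcst _ Ha) -(lcst _ Hb).
apply: cvg_unique (ua l lb) _ => //.
have -> : (fun k => l (Lfun_Sub (lexx 1%E) (Hu1 k))) =
          (fun k => l (Lfun_Sub (lexx 1%E) (Hu2 k))).
  by apply/funext => k; congr (l _); exact/LfuneqP.
exact: ub.
Qed.

Lemma digit_weak_cvg {R : realType} (N : nat) (A g : nat -> R)
    (A_nd : {homo A : a b / (a <= b)%N >-> a <= b})
    (A0 : A 0%N = 0) (AN : A N = 1) :
  weak_cvg (mu01 R) (lexx 1%E) (fun k => digit N A g k 0 1)
    (cst (\sum_(a < N) (A a.+1 - A a) * g a)).
Proof.
set m := \sum_(a < N) _.
have mufin : mu01 R setT \is a fin_num by rewrite [X in X \is a _]mu01_setT.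
have dL k : digit N A g k 0 1 \in Lfun (mu01 R) 1.
  apply: (bounded_Lfun _ _ _ _ _ _ (\sum_(a < N) `|g a|)) => //.
    exact: measurable_digit.
  by move=> x; exact: digit_bounded.
have mL : cst m \in Lfun (mu01 R) 1.
  exact: (bounded_Lfun _ _ _ _ _ _ `|m|).
exists dL, mL => l lb.
pose y k : LfunType (mu01 R) (lexx 1%E) :=
  Lfun_Sub (lexx 1%E) (dL k) - Lfun_Sub (lexx 1%E) mL.
have my k : measurable_fun setT (y k).
  exact: measurable_funB (measurable_digit g k 0 1) (measurable_cst m).
suff : l (y k) @[k --> \oo] --> (0 : R).
  under eq_fun do rewrite linearB.
  by move=> /cvg_sub0 /(_ (cvg_cst _)).
apply: (bounded_functional_cvg0 _ _ _ _ _
  (\sum_(a < N) (A a.+1 - A a) * (g a - m) ^+ 2)) => //.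
  exact: mu01_setT.
move=> c p; rewrite ge0_integral_mu01; last 2 first.
- apply/measurable_EFinP/measurable_funX.
  by apply: measurable_sum => k; apply: measurable_funM; [|exact: my].
- by move=> x; rewrite lee_fin sqr_ge0.
have := @integral_digit_sqr R (mu01 R) N A g m mu01_itv A_nd A0 AN erefl
  p c 0 0 1.
rewrite add0r mul1r expr0n/= add0r => <-//.
rewrite le_eqVlt; apply/orP; left; apply/eqP.
by apply: eq_integral => x _; rewrite add0r.
Qed.

(** * Weak limits of compositions and the theorem *)

Lemma weak_cvg_cst_seq d (T : measurableType d) (R : realType)
    (mu : {measure set T -> \bar R}) (c : R) :
  mu setT \is a fin_num ->
  weak_cvg mu (lexx 1%E) (fun=> cst c) (cst c).
Proof.
move=> mufin.
have cL : cst c \in Lfun mu 1 by exact: (bounded_Lfun _ _ _ _ _ _ `|c|).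
by exists (fun=> cL), cL => l _; exact: cvg_cst.
Qed.

(** One sequence v serves all functions f at once: f takes the digits with
    values t a to the digits with values f (t a). *)
Lemma weak_cvg_mean {R : realType} (N : nat) (w t : nat -> R) :
  (forall a, 0 <= w a) -> \sum_(a < N) w a = 1 ->
  exists v : nat -> R -> R,
    (forall k, v k \in Lfun (mu01 R) +oo%E) /\
    forall f : R -> R, f 0 = 0 ->
      weak_cvg (mu01 R) (lexx 1%E) (fun k => f \o v k)
        (cst (\sum_(a < N) w a * f (t a))).
Proof.
move=> w0 w1; pose A a := \sum_(b < a) w b.
have AS a : A a.+1 - A a = w a by rewrite /A big_ord_recr/= addrAC subrr add0r.
have A_nd : {homo A : a b / (a <= b)%N >-> a <= b}.
  by apply/nondecreasing_seqP => a; rewrite -subr_ge0 AS.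
exists (fun k => digit N A t k 0 1); split => [k|f f0].
  apply: (bounded_Lfun _ _ _ _ _ _ (\sum_(a < N) `|t a|)) => //.
  - exact: leey.
  - by rewrite [X in X \is a _]mu01_setT.
  - exact: measurable_digit.
  - by move=> x; exact: digit_bounded.
have := digit_weak_cvg N A (f \o t) A_nd.
rewrite {1}/A big_ord0 => /(_ erefl w1).
under eq_bigr do rewrite AS.
congr (weak_cvg _ _ _ _); apply/funext => k; apply/funext => x /=.
by rewrite comp_digit.
Qed.

(* The number of functions is M = n.+1, and phi ord_max is the last one. *)
Theorem theorem3p3 (R : realType) (n : nat) (phi : 'I_n.+1 -> R -> R)
  (phi_cont : forall i, continuous (phi i))
  (phi_odd : forall i, i != ord_max -> forall t, phi i (- t) = - phi i t)
  (q C : R) (q_ge1 : 1 <= q) (C_gt0 : 0 < C)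
  (phi_growth : forall i t, `|phi i t| <= C * (1 + `|t| `^ q))
  (phi_weak : forall v : nat -> R -> R,
    (forall k, v k \in Lfun (mu01 R) +oo%E) ->
    (forall i, i != ord_max ->
      weak_cvg (mu01 R) (lexx 1%E) (fun k => phi i \o v k) (cst 0)) ->
    weak_cvg (mu01 R) (lexx 1%E) (fun k => phi ord_max \o v k) (cst 0)) :
  linearly_dependent phi.
Proof.
have mufin : mu01 R setT \is a fin_num by rewrite [X in X \is a _]mu01_setT.
have odd0 i : i != ord_max -> phi i 0 = 0.
  by move=> /phi_odd /(_ 0); rewrite oppr0 => phi0; lra.
(* For the zero sequence, phi_M (v_k) is the constant phi_M (0), whose weak
   limit is itself. *)
have max0 : phi ord_max 0 = 0.
  apply: (weak_cvg_cst_unique _ _ _ (mu01 R) (fun=> cst (phi ord_max 0)) _ _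
    mu01_setT (weak_cvg_cst_seq _ _ _ _ _ mufin)).
  apply: (phi_weak (fun=> cst 0)) => [k|i iN].
    apply: (bounded_Lfun _ _ _ _ _ _ 0) => //; first exact: leey.
    by move=> x; rewrite normr0.
  have := weak_cvg_cst_seq _ _ _ (mu01 R) (phi i 0) mufin.
  by rewrite [X in weak_cvg _ _ _ (cst X)]odd0.
have mean0 (N : nat) (w t : nat -> R) :
    (forall a, 0 <= w a) -> \sum_(a < N) w a = 1 ->
    (forall i, i != ord_max -> \sum_(a < N) w a * phi i (t a) = 0) ->
    \sum_(a < N) w a * phi ord_max (t a) = 0.
  move=> w0 w1 wphi; have [v [vL vcvg]] := weak_cvg_mean N w t w0 w1.
  apply: (weak_cvg_cst_unique _ _ _ (mu01 R) _ _ _ mu01_setT (vcvg _ max0)).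
  by apply: phi_weak => // i iN; rewrite -(wphi i iN); exact/vcvg/odd0.
have max_odd t : phi ord_max (- t) = - phi ord_max t.
  have H : \sum_(a < 2) 2^-1 *
      phi ord_max (if a == 0%N :> nat then t else - t) = 0.
    apply: (mean0 2%N (fun=> 2^-1) (fun a => if a == 0%N then t else - t)).
    - by move=> _; rewrite invr_ge0.
    - by rewrite !big_ord_recl big_ord0; field.
    - by move=> i iN; rewrite !big_ord_recl big_ord0/= phi_odd//; ring.
  by move: H; rewrite !big_ord_recl big_ord0/= => H; lra.
have {max_odd}phi_odd i t : phi i (- t) = - phi i t.
  by have [->|/phi_odd] := eqVneq i ord_max.
have [//|[t tU]] := linearly_dependent_or_unitmx _ _ phi.
set M := \matrix_(i, j) _ in tU.
pose c : 'rV_n.+1 := delta_mx 0 ord_max *m invmx M.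
have cphi j : \sum_a c 0 a * phi j (t a) = (j == ord_max)%:R.
  have : (c *m M) 0 j = (j == ord_max)%:R.
    by rewrite /c mulmxKV// mxE eqxx.
  by rewrite mxE => <-; apply: eq_bigr => a _; rewrite [M a j]mxE.
pose W := \sum_a `|c 0 a|.
have W0 : 0 < W.
  rewrite lt_def sumr_ge0// andbT; apply/eqP => W0.
  have c0 a : c 0 a = 0.
    by apply: normr0_eq0; apply: (psumr_eq0P _ W0) => // b _; exact: normr_ge0.
  have := cphi ord_max; rewrite big1 ?eqxx => [/esym/eqP|a _].
    by rewrite oner_eq0.
  by rewrite c0 mul0r.
(* The sign of c 0 a is moved from the coefficient to the point. *)
pose w a := `|c 0 (inord a)| / W.
pose s a := Num.sg (c 0 (inord a)) * t (inord a).
have wphi j : \sum_(a < n.+1) w a * phi j (s a) = (j == ord_max)%:R / W.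
  rewrite -cphi mulr_suml; apply: eq_bigr => a _.
  rewrite /w /s inord_val mulrAC; congr (_ / W).
  rewrite [c 0 a in RHS]numEsg; case: sgrP => _.
  - by rewrite !mul0r.
  - by rewrite !mul1r.
  - by rewrite !mulN1r phi_odd; ring.
have := mean0 n.+1 w s; rewrite wphi eqxx mul1r => w_mean.
suff : W^-1 = 0 by move=> /eqP; rewrite invr_eq0 gt_eqF.
apply: w_mean => [a||j jN]; first by rewrite divr_ge0// ltW.
  rewrite -mulr_suml; under eq_bigr do rewrite inord_val.
  by rewrite divff// gt_eqF.
by rewrite wphi (negbTE jN) mul0r.
Qed.
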